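(* Let $K\subseteq L$ be a finite separable field extension of degree $n>1$. Then $$\mathcal{C}(L/K)=n-d_{\max}(L/K).$$
   Context: Let $K\subseteq L$ be a finite field extension with $[L:K]>1$. A nonzero $K$-subspace $A\subseteq L$ is called a Chowla subspace if $[K(a):K]>\dim_K A$ for every $0\ne a\in A$. Define $\mathcal{C}(L/K)=\max\{\dim_K A:A\subseteq L\text{ is a Chowla }K\text{-subspace}\}$ and $d_{\max}(L/K)=\max\{[E:K]:K\subseteq E\subsetneq L\}$, the maximum over proper intermediate fields $E$ (with $E=K$ allowed). *)

(* Defs.v *)
From mathcomp Require Import all_boot all_order all_algebra all_field.
From mathcomp Require Import boolp.

Set Implicit Arguments.
Unset Strict Implicit.
Unset Printing Implicit Defensive.

Section Chowla.
Variables (K : fieldType) (L : fieldExtType K).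

Definition is_chowla (A : {vspace L}) : Prop :=
  A <> 0%VS /\
  forall a : L, a \in A -> a != 0%R -> \dim A < \dim <<1; a>>%VS.

(* Subspaces and intermediate fields range over possibly infinite types, so the
   two maxima below are taken over the attained dimensions, all of which are at
   most [\dim {:L}]. The lemmas [chowla_number_max] and [dmax_max] show that,
   for a nontrivial extension, both are maxima of nonempty sets: the default
   value 0 of [\max] plays no role. *)
Definition chowla_number : nat :=
  \max_(m < (\dim {:L}).+1 |
        `[< exists A : {vspace L}, is_chowla A /\ \dim A = m >]) m.

(* [K] sits in [L] as [1%VS], which every [E : {subfield L}] contains. *)
Definition dmax : nat :=
  \max_(m < (\dim {:L}).+1 |
        `[< exists E : {subfield L},
              (E : {vspace L}) <> {:L}%VS /\ \dim E = m >]) m.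

Lemma bigmax_attained (N : nat) (P : nat -> Prop) :
  (forall m, P m -> m <= N) -> (exists m, P m) ->
  let M := \max_(m < N.+1 | `[< P m >]) m in
  P M /\ forall m, P m -> m <= M.
Proof.
move=> PN [m0 Pm0] M.
have ltN m : P m -> m < N.+1 by rewrite ltnS; apply: PN.
have Pi0 : `[< P (Ordinal (ltN _ Pm0)) >] by apply/asboolP.
split.
  have [|i /asboolP Pi Mi] :=
    @eq_bigmax_cond _ [pred m : 'I_N.+1 | `[< P m >]] (fun m : 'I_N.+1 => m : nat).
    by apply/card_gt0P; exists (Ordinal (ltN _ Pm0)).
  by rewrite /M [X in P X]Mi.
move=> m Pm.
by apply: (@leq_bigmax_cond _ (fun m : 'I_N.+1 => `[< P m >])
             (fun m : 'I_N.+1 => m : nat) (Ordinal (ltN _ Pm))); apply/asboolP.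
Qed.

Lemma chowla_number_max : 1 < \dim {:L} ->
  (exists A : {vspace L}, is_chowla A /\ \dim A = chowla_number) /\
  (forall A : {vspace L}, is_chowla A -> \dim A <= chowla_number).
Proof.
move=> n_gt1.
have [||[A HA] H] := @bigmax_attained (\dim {:L})
  (fun m => exists A : {vspace L}, is_chowla A /\ \dim A = m).
- by move=> m [A [_ <-]]; exact/dimvS/subvf.
- have /subvPn[a _ a1] : ~~ ({:L} <= 1)%VS.
    by apply: contraL n_gt1 => /dimvS; rewrite dimv1 -leqNgt.
  have a0 : a != 0%R by apply: contraNneq a1 => ->; exact: mem0v.
  have da : \dim <[a]>%VS = 1 by rewrite dim_vline a0.
  exists 1, <[a]>%VS; split => //; split => [ea|b]; first by rewrite ea dimv0 in da.
  rewrite da => /vlineP[k ->] ka.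
  have k0 : k != 0%R by apply: contraNneq ka => ->; rewrite GRing.scale0r.
  rewrite ltnNge; apply: contra a1 => le1.
  have /eqP e1 : (1%VS == <<1; (k *: a)%R>>%VS).
    by rewrite eqEdim subv_adjoin dimv1.
  rewrite -[a]GRing.scale1r -(GRing.mulVf k0) -GRing.scalerA memvZ //.
  by rewrite e1 memv_adjoin.
by split; [exists A | move=> B cB; apply: H; exists B].
Qed.

Lemma dmax_max : 1 < \dim {:L} ->
  (exists E : {subfield L}, (E : {vspace L}) <> {:L}%VS /\ \dim E = dmax) /\
  (forall E : {subfield L}, (E : {vspace L}) <> {:L}%VS -> \dim E <= dmax).
Proof.
move=> n_gt1.
have [||[E HE] H] := @bigmax_attained (\dim {:L})
  (fun m => exists E : {subfield L}, (E : {vspace L}) <> {:L}%VS /\ \dim E = m).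
- by move=> m [A [_ <-]]; exact/dimvS/subvf.
- exists 1, 1%AS; rewrite dimv1; split => // e.
  by move: n_gt1; rewrite -e dimv1.
by split; [exists E | move=> F hF; apply: H; exists F].
Qed.

End Chowla.

Arguments chowla_number {K} L.
Arguments dmax {K} L.

(* Main.v *)
Require Import Defs.
From HB Require Import structures.
From mathcomp Require Import all_boot all_order all_algebra all_field.
From mathcomp Require Import boolp.

(** Write [n = [L : K]] and [d = dmax L]. Since degrees of intermediate fields
    divide [n], a proper one has degree at most [n / 2], so [d <= n - d].

    Upper bound. Let [E] be a proper intermediate field of degree [d]. A
    subspace of dimension more than [n - d] meets [E] in some [a != 0], and
    [[K(a) : K] <= d <= n - d], so the subspace is not Chowla.

    Lower bound. It is enough to find a subspace [A] of dimension [n - d] all of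
    whose nonzero elements generate [L]: they then have degree [n > n - d]. The
    elements that do not generate [L] form a cone, and [subspace_avoiding]
    builds [A] one vector at a time, provided that for every [A] of dimension
    less than [n - d] some [x] lies outside [A + {nongenerators}].

    - If [K] has [q] elements, [x] is found by counting ([finite_escape]). An
      intermediate field of degree [j] is the set of solutions of
      [x ^ (q ^ j) = x], so there is at most one for each [j]. Hence
      [A + {nongenerators}] has at most
      [q ^ dim A * (1 + q + ... + q ^ d) < q ^ (dim A + d + 1) <= q ^ n]
      elements.
    - If [K] is infinite, finitely many proper intermediate fields cover the
      nongenerators ([nongenerators_covered], where separability enters). Each
      [A + E] is a proper subspace by dimension, and finitely many proper
      subspaces do not cover a space over an infinite field
      ([proper_subspaces_not_cover]). *)

Set Implicit Arguments.
Unset Strict Implicit.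
Unset Printing Implicit Defensive.

Import GRing.Theory.
Local Open Scope ring_scope.

(** * Avoiding a cone by a subspace *)

Section Greedy.
Variables (K : fieldType) (L : vectType K) (N : L -> Prop).
Hypothesis N0 : N 0.
Hypothesis NZ : forall (c : K) x, N x -> N (c *: x).

(** If [x] is not in [A + N], then [A + <[x]>] still meets [N] trivially: from
    [a + c *: x] in [N] with [c != 0], dividing by [c] puts [x] in [A + N]. *)
Lemma subspace_avoiding (m : nat) :
    (forall A : {vspace L}, (\dim A < m)%N ->
       exists x, forall a b, a \in A -> N b -> x <> a + b) ->
  exists A : {vspace L}, \dim A = m /\ forall a, a \in A -> N a -> a = 0.
Proof.
elim: m => [_|m IHm step].
  by exists 0%VS; split=> [|a]; [rewrite dimv0 | rewrite memv0 => /eqP].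
have [A [dA AN]] := IHm (fun A lt_Am => step A (ltnW lt_Am)).
have [|x xAN] := step A; first by rewrite dA.
have xA : x \notin A by apply/negP=> xA; apply: (xAN x 0) => //; rewrite addr0.
exists (A + <[x]>)%VS; split.
  rewrite dimv_disjoint_sum ?dA ?dim_vline.
    have -> : x != 0 by apply: contraNneq xA => ->; exact: mem0v.
    by rewrite addn1.
  apply/eqP; rewrite -subv0; apply/subvP=> y; rewrite memv_cap => /andP[yA].
  case/vlineP=> c Dy; have [c0|c0] := eqVneq c 0.
    by rewrite Dy c0 scale0r mem0v.
  by case/negP: xA; rewrite -[x]scale1r -(mulVf c0) -scalerA -Dy memvZ.
move=> _ /memv_addP[a aA [_ /vlineP[c ->] ->]].
have [->|c0] := eqVneq c 0; first by rewrite scale0r addr0; exact: AN.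
move=> Nacx; case: (xAN (c^-1 *: - a) (c^-1 *: (a + c *: x))).
- by rewrite memvZ ?rpredN.
- exact: NZ.
by rewrite scalerDr addrA scalerN addNr add0r scalerA mulVf ?scale1r.
Qed.

End Greedy.

(** Let [x] avoid [Vs] but not [V], and let [y] avoid [V]. Every point of the
    line [y + c *: x] avoids [V]. Two of its points in a common member of [Vs]
    would put [x] there, so each member contains at most one of them. *)
Lemma proper_subspaces_not_cover (K : fieldType) (L : vectType K)
    (Vs : seq {vspace L}) :
    (forall N : nat, exists s : seq K, uniq s /\ size s = N) ->
    (forall V, V \in Vs -> V != fullv) ->
  exists x, forall V, V \in Vs -> x \notin V.
Proof.
move=> large; elim: Vs => [|V Vs IHVs] proper; first by exists 0.
have [W WVs|x xVs] := IHVs; first by apply: proper; rewrite inE WVs orbT.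
have [xV|xV] := boolP (x \in V); last first.
  by exists x => W; rewrite inE => /orP[/eqP->|/xVs].
have /subvPn[y _ yV] : ~~ (fullv <= V)%VS.
  by have := proper V; rewrite inE eqxx eqEsubv subvf => /(_ isT).
have [s [us sz_s]] := large (size Vs).+1.
have [c good] : exists c, forall W, W \in Vs -> y + c *: x \notin W.
  apply: contrapT => /forallNP bad.
  have badW c : exists W, (W \in Vs) && (y + c *: x \in W).
    apply: contrapT => /forallNP badW; apply: (bad c) => W WVs.
    by apply/negP=> yW; apply: (badW W); rewrite WVs.
  pose f c := xchoose (badW c).
  have fVs c : f c \in Vs by have /andP[] := xchooseP (badW c).
  have fP c : y + c *: x \in f c by have /andP[] := xchooseP (badW c).
  have inj_f : injective f.
    move=> c c' Ef; apply/eqP; apply: contraT => ne_cc.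
    have: (y + c *: x) - (y + c' *: x) \in f c by rewrite rpredB // Ef.
    rewrite opprD addrACA subrr add0r -scalerBl => fx.
    case/negP: (xVs _ (fVs c)).
    rewrite -[x]scale1r -(@mulVf _ (c - c')) ?subr_eq0 // -scalerA.
    exact: memvZ.
  have : (size (map f s) <= size Vs)%N.
    by apply: uniq_leq_size => [|_ /mapP[c _ ->]]; rewrite ?map_inj_uniq.
  by rewrite size_map sz_s ltnn.
exists (y + c *: x) => W; rewrite inE => /orP[/eqP->|]; last exact: good.
by rewrite rpredDr // memvZ.
Qed.

(** * Finitely many fields contain all nongenerators *)

(** The subspace is one of maximal dimension inside [P]: it absorbs every
    vector satisfying [P]. *)
Lemma closed_vspace (K : fieldType) (L : vectType K) (P : L -> Prop) :
    P 0 -> (forall (c : K) x y, P x -> P y -> P (c *: x + y)) ->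
  exists V : {vspace L}, forall x, x \in V <-> P x.
Proof.
move=> P0 Plin; pose Q (V : {vspace L}) := forall x, x \in V -> P x.
have [||[V [QV dV]] maxV] := @bigmax_attained (\dim {: L})
  (fun m => exists V : {vspace L}, Q V /\ \dim V = m).
- by move=> m [V [_ <-]]; exact/dimvS/subvf.
- by exists 0%N, 0%VS; split=> [x|]; rewrite ?dimv0 // memv0 => /eqP->.
exists V => x; split=> [|Px]; first exact: QV.
have QVx : Q (V + <[x]>)%VS.
  move=> _ /memv_addP[v /QV Pv [_ /vlineP[c ->] ->]].
  by rewrite addrC; apply: Plin.
suff /eqP-> : V == (V + <[x]>)%VS
  by exact: (subvP (addvSr V _) _ (memv_line x)).
by rewrite eqEdim addvSl dV maxV //; exists (V + <[x]>)%VS.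
Qed.

(** A weak form of factorization into irreducibles. If [f = h * g]
    properly, a divisor [k] of [f] either shares a factor with [g] or is coprime
    to [g] and then divides [h], so the lists for [g] and [h] together work for
    [f]. *)
Lemma divisor_basis (F : fieldType) (f : {poly F}) : f != 0 ->
  exists ps : seq {poly F},
    (forall p, p \in ps -> p %| f /\ (1 < size p)%N) /\
    (forall g, g %| f -> (1 < size g)%N -> exists2 p, p \in ps & p %| g).
Proof.
have [n] := ubnP (size f); elim: n f => // n IHn f; rewrite ltnS => le_fn nz_f.
have [[g [gf g1 lt_gf]]|irr_f] :=
    pselect (exists g, [/\ g %| f, (1 < size g)%N & (size g < size f)%N]).
  have nz_g : g != 0 by apply: dvdpN0 gf nz_f.
  have Df : f = (f %/ g) * g by rewrite divpK.
  set h := f %/ g in Df.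
  have nz_h : h != 0 by apply: contraNneq nz_f => h0; rewrite Df h0 mul0r.
  have hf : h %| f by rewrite Df dvdp_mulr.
  have lt_hf : (size h < size f)%N.
    rewrite Df size_mul //; case: (size g) g1 => [|[|k]] // _.
    by rewrite !addnS ltnS leq_addr.
  have [ps [psg psP]] := IHn g (leq_trans lt_gf le_fn) nz_g.
  have [qs [qsh qsP]] := IHn h (leq_trans lt_hf le_fn) nz_h.
  exists (ps ++ qs); split=> [p|k kf k1].
    rewrite mem_cat => /orP[/psg[pg p1]|/qsh[ph p1]]; split=> //.
      exact: dvdp_trans pg gf.
    exact: dvdp_trans ph hf.
  have nz_k : k != 0 by apply: dvdpN0 kf nz_f.
  have [ckg|ckg] := boolP (coprimep k g).
    have [|p pqs pk] := qsP k _ k1; first by rewrite -(Gauss_dvdpl _ ckg) -Df.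
    by exists p; rewrite // mem_cat pqs orbT.
  have [||p pps pkg] := psP (gcdp k g); first exact: dvdp_gcdr.
    rewrite ltn_neqAle eq_sym size_poly_gt0 gcdp_eq0 negb_and nz_k andbT.
    by rewrite coprimep_def in ckg.
  exists p; first by rewrite mem_cat pps.
  exact: dvdp_trans pkg (dvdp_gcdl _ _).
have [f1|f1] := ltnP 1 (size f); last first.
  exists [::]; split=> // g gf g1; have := leq_trans (dvdp_leq nz_f gf) f1.
  by rewrite leqNgt g1.
exists [:: f]; split=> [p|g gf g1]; first by rewrite inE => /eqP->.
exists f; first by rewrite inE.
have [lt_gf|] := ltnP (size g) (size f); first by case: irr_f; exists g.
rewrite leq_eqVlt ltnNge (dvdp_leq nz_f gf) orbF => /eqP Esz.
by have := dvdp_size_eqp gf; rewrite Esz eqxx => /esym; rewrite /eqp => /andP[].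
Qed.

Section Nongenerators.
Variables (K : fieldType) (L : fieldExtType K).

Definition nongenerator (a : L) : Prop := <<1; a>>%VS <> {: L}%VS.

Lemma closed_subfield (P : L -> Prop) :
    P 1 -> (forall (c : K) x y, P x -> P y -> P (c *: x + y)) ->
    (forall x y, P x -> P y -> P (x * y)) ->
  exists E : {subfield L}, forall x, x \in E <-> P x.
Proof.
move=> P1 Plin Pmul.
have P0 : P 0 by rewrite -(addNr 1) -scaleN1r; apply: Plin.
have [V VP] := closed_vspace P0 Plin.
have Valg : is_aspace V.
  apply/andP; split; first by apply: has_algid1; apply/VP.
  by apply/prodvP=> u v /VP Pu /VP Pv; apply/VP/Pmul.
by exists (ASpace Valg).
Qed.

(** Let [t] be a primitive element, [f] its minimal polynomial over [K], and
    [q = f / ('X - t)]. For [p] dividing [q], the elements [h.[t]], with [h]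
    over [K] and [h = h.[t]] modulo [p], form an intermediate field: it is where
    the two maps [L -> L[X] / p] sending [t] to ['X] and to [t] agree. When [p] is
    not constant the field is proper, because [t] in it would make [p] divide
    ['X - t], a double factor of the separable [f]. Conversely, if [K(a) != L],
    the minimal polynomial of [t] over [K(a)] has degree at least 2 and divides
    [h - a] for any [h] over [K] with [h.[t] = a]; so [a] belongs to the field
    of any [p] dividing its quotient by ['X - t]. Finitely many [p] suffice by
    [divisor_basis]. *)
Lemma nongenerators_covered : separable 1%VS {: L}%VS ->
  exists Vs : seq {vspace L},
    (forall V, V \in Vs -> exists2 E : {subfield L}, V = E &
       E != {: L}%VS :> {vspace L}) /\
    (forall a, nongenerator a -> exists2 V, V \in Vs & a \in V).
Proof.
move=> sepL.
pose t := separable_generator 1%VS {: L}%VS.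
have Dt : {: L}%VS = <<1; t>>%VS.
  by apply: eq_adjoin_separable_generator; rewrite ?sub1v.
have sep_f : separable_poly (minPoly 1 t) by exact: separable_generatorP.
set f := minPoly 1 t in sep_f.
have nz_f : f != 0 by exact/monic_neq0/monic_minPoly.
have Df : f = (f %/ ('X - t%:P)) * ('X - t%:P).
  by rewrite divpK // dvdp_XsubCl root_minPoly.
set q := f %/ _ in Df.
have nz_q : q != 0 by apply: contraNneq nz_f => q0; rewrite Df q0 mul0r.
have [ps [psq psP]] := divisor_basis nz_q.
pose P p a := exists h : {poly L},
  [/\ h \is a polyOver 1%VS, h.[t] = a & p %| h - a%:P].
have PE p : exists E : {subfield L}, forall x, x \in E <-> P p x.
  apply: closed_subfield.
  - by exists 1; rewrite rpred1 hornerC subrr dvdp0.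
  - move=> c _ _ [h [Kh <- ph]] [k [Kk <- pk]].
    exists (c%:A *: h + k); rewrite !hornerE mulr_algl; split=> //.
      by rewrite rpredD // polyOverZ // memvZ ?mem1v.
    rewrite polyCD -[c *: h.[t]]mulr_algl polyCM mul_polyC.
    rewrite opprD addrACA -scalerBr.
    by rewrite -mul_polyC dvdp_add // dvdp_mull.
  move=> _ _ [h [Kh <- ph]] [k [Kk <- pk]].
  exists (h * k); rewrite rpredM // hornerM; split=> //.
  rewrite -(subrKA (h * k.[t]%:P)) -mulrBr polyCM -mulrBl.
  by apply: dvdp_add; [apply: dvdp_mull | apply: dvdp_mulr].
have [E EP] := choice PE.
exists [seq (E p : {vspace L}) | p <- ps].
split=> [_ /mapP[p /psq[pq p1] ->]|a].
  exists (E p) => //; apply: contraTneq p1 => Ep.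
  have [h [Kh ht ph]] : P p t by apply/EP; rewrite /= Ep memvf.
  (* Modulo [p] both [h = t] and [h = 'X] hold. *)
  have fh : f %| h - 'X.
    apply: minPoly_dvdp; first by rewrite rpredB ?polyOverX.
    by rewrite /root !hornerE ht subrr.
  have pX : p %| 'X - t%:P.
    rewrite -(subrKA h) -[_ - h]opprB addrC dvdp_sub //.
    by apply: dvdp_trans fh; rewrite Df dvdp_mulr.
  have: coprimep q ('X - t%:P) by apply: (separable_coprime sep_f); rewrite -Df.
  move/coprimepP/(_ p pq pX); rewrite -size_poly_eq1 => /eqP->.
  by [].
move=> nga; set Ka := <<1; a>>%AS.
have t_notin : t \notin Ka.
  apply/negP=> tKa; apply: nga; apply/eqP; rewrite eqEsubv subvf Dt.
  by apply/FadjoinP; rewrite sub1v.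
set g := minPoly Ka t.
have gXt : 'X - t%:P %| g by rewrite dvdp_XsubCl root_minPoly.
have [||p pps pg] := psP (g %/ ('X - t%:P)).
- rewrite -(@dvdp_mul2r _ ('X - t%:P)) ?polyXsubC_eq0 // -Df divpK //.
  exact/minPolyS/sub1v.
- rewrite size_divp ?polyXsubC_eq0 // size_XsubC size_minPoly subn1 /=.
  by rewrite ltn_neqAle eq_sym adjoin_deg_eq1 t_notin.
exists (E p : {vspace L}); first by apply: (map_f (fun p => E p : {vspace L})).
apply/EP; have /Fadjoin_polyP[h Kh ht] : a \in <<1; t>>%VS by rewrite -Dt memvf.
exists h; split=> //; apply: dvdp_trans (dvdp_trans pg (divp_dvd gXt)) _.
apply: minPoly_dvdp; last by rewrite /root !hornerE -ht subrr.
rewrite rpredB ?polyOverC ?memv_adjoin //.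
by apply: polyOverSv Kh; exact: sub1v.
Qed.
End Nongenerators.

(** * Escaping the nongenerators over a finite field *)

Lemma eq_dim_subfield (K : finFieldType) (L : fieldExtType K)
    (E F : {subfield L}) : \dim E = \dim F -> E =i F.
Proof. by move=> dimEF x; rewrite !Fermat's_little_theorem dimEF. Qed.

(** The nongenerators of degree [j] all lie in the one subfield of that degree,
    so there are at most [q ^ j] of them; summing over [j <= d] counts
    [A + {nongenerators}]. *)
Lemma finite_escape (K : finFieldType) (L : fieldExtType K) (d : nat)
    (A : {vspace L}) :
    (forall E : {subfield L}, E != {: L}%VS :> {vspace L} -> (\dim E <= d)%N) ->
    (\dim A < \dim {: L} - d)%N ->
  exists x, forall a b, a \in A -> nongenerator b -> x <> a + b.
Proof.
move=> dP lt_A; pose fT : finType := finvect_type L.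
have cardv (V : {vspace L}) : #|[set x : fT | x \in V]| = (#|K| ^ \dim V)%N.
  rewrite cardsE; exact: (@card_vspace K fT _ V).
pose B (j : nat) :=
  [set b : fT | `[< nongenerator (b : L) >] & (\dim <<1; b : L>>%VS == j)%N].
pose Aset := [set x : fT | (x : L) \in A].
have cardB j : (#|B j| <= #|K| ^ j)%N.
  have [->|[b]] := set_0Vmem (B j); first by rewrite cards0.
  rewrite inE => /andP[_ /eqP dimb].
  rewrite -dimb -cardv; apply/subset_leq_card/subsetP => c.
  rewrite !inE => /andP[_ /eqP dimc].
  rewrite -(@eq_dim_subfield _ _ <<1; (c : L)>>%AS <<1; (b : L)>>%AS) ?dimc //.
  exact: memv_adjoin.
pose addT (x y : fT) : fT := (x : L) + (y : L).
pose S := \bigcup_(j < d.+1) addT @2: (Aset, B j).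
have ltS : (#|S| < #|fT|)%N.
  have leS : (#|S| <= \sum_(j < d.+1) #|K| ^ \dim A * #|K| ^ j)%N.
    rewrite /S; elim/big_ind2: _ => [|X m Y k leX leY|j _].
    - by rewrite cards0.
    - by apply: leq_trans (leq_add leX leY); rewrite cardsU leq_subr.
    rewrite curry_imset2X -cardv; apply: leq_trans (leq_imset_card _ _) _.
    by rewrite cardsX leq_mul2l cardB orbT.
  have q1 : (1 < #|K|)%N := finNzRing_gt1 K.
  have -> : #|fT| = (#|K| ^ \dim {: L})%N.
    by rewrite -cardv; apply: eq_card => x; rewrite inE memvf.
  apply: leq_ltn_trans leS _; rewrite -big_distrr /=.
  apply: (@leq_trans (#|K| ^ \dim A * #|K| ^ d.+1)%N).
    rewrite ltn_pmul2l ?expn_gt0 ?(ltnW q1) //.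
    rewrite -[ltnRHS]prednK ?expn_gt0 ?(ltnW q1) // ltnS predn_exp leq_pmull //.
    by rewrite -ltnS prednK // ltnW.
  rewrite -expnD leq_exp2l // addnS -addSn.
  by rewrite addnC -leq_subRL // ltnW // -subn_gt0 (leq_ltn_trans _ lt_A).
have [x xS] : exists x, x \notin S.
  apply/existsP; rewrite -negb_forall; apply: contraL ltS => /forallP ST.
  by rewrite -leqNgt; apply/subset_leq_card/subsetP.
exists (x : L) => a b aA Nb Dx; case/negP: xS.
have ltb : (\dim <<1; b>>%VS < d.+1)%N.
  by rewrite ltnS (dP <<1; b>>%AS) //; apply/eqP.
apply/bigcupP; exists (Ordinal ltb) => //.
apply/imset2P; exists (a : fT) (b : fT) => //; rewrite inE //=.
by apply/andP; split=> //; apply/asboolP.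
Qed.

(** * The two cases for the base field *)

Lemma finite_or_large (T : choiceType) :
  (exists s : seq T, forall x, x \in s) \/
  (forall N : nat, exists s : seq T, uniq s /\ size s = N).
Proof.
have [fin|nfin] := pselect (exists s : seq T, forall x, x \in s); first by left.
right; elim=> [|N [s [us <-]]]; first by exists [::].
have [x xs] : exists x, x \notin s.
  apply: contrapT => /forallNP H; apply: nfin; exists s => x.
  by apply: contrapT => /negP; exact: H.
by exists (x :: s); rewrite /= xs us.
Qed.

(** Equality of the bundled fields, rather than a mere bijection, is what allows
    [F] to replace [K] under an extension of [K]. *)
Lemma finFieldType_of_seq (K : fieldType) (s : seq K) :
  (forall x, x \in s) -> exists F : finFieldType, K = F :> fieldType.
Proof.
move=> sP; have indexK : pcancel (index^~ s) (fun i => ohead (drop i s)).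
  by move=> x; rewrite (drop_nth x) ?index_mem //= nth_index.
have enumP : Finite.axiom (undup s).
  by move=> x; rewrite count_uniq_mem ?undup_uniq // mem_undup sP.
have cK := PCanIsCountable indexK.
move: (undup s) enumP => e {s sP indexK}.
(* Exposing the components of [K] makes the repacked field convertible
   to it. *)
case: K e cK => T [m1 m2 m3 m4 m5 m6 m7 m8 m9 m10 m11 m12 m13 m14 m15].
move=> e cK enumP.
set K := GRing.Field.Pack _ in e cK enumP *.
pose KC : countType := HB.pack (K : Type) K cK.
pose KF : finType := HB.pack (K : Type) KC (@isFinite.Build KC _ enumP).
pose F : finFieldType := HB.pack (K : Type) K KF.
by exists F.
Qed.

Section Escape.
Variables (K : fieldType) (L : fieldExtType K) (d : nat).
Hypothesis dP :
  forall E : {subfield L}, E != {: L}%VS :> {vspace L} -> (\dim E <= d)%N.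

Lemma finite_field_escape (s : seq K) (A : {vspace L}) :
    (forall x, x \in s) -> (\dim A < \dim {: L} - d)%N ->
  exists x, forall a b, a \in A -> nongenerator b -> x <> a + b.
Proof.
case/finFieldType_of_seq=> F DK.
by move: L d dP A; rewrite DK => L' d' dP' A; apply: finite_escape.
Qed.

Lemma large_field_escape (A : {vspace L}) :
    separable 1%VS {: L}%VS ->
    (forall N : nat, exists s : seq K, uniq s /\ size s = N) ->
    (\dim A < \dim {: L} - d)%N ->
  exists x, forall a b, a \in A -> nongenerator b -> x <> a + b.
Proof.
move=> sepL large lt_A.
have [Vs [properVs coverVs]] := nongenerators_covered sepL.
have [_ /mapP[V /properVs[E -> Eproper] ->]|x xVs] :=
  @proper_subspaces_not_cover K L [seq (A + V)%VS | V <- Vs] large.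
  apply: contraTneq lt_A => AE; rewrite -leqNgt leq_subLR -AE.
  by rewrite (leq_trans (dimv_add_leqif _ _)) // addnC leq_add2r dP.
exists x => a b aA /coverVs[V VVs bV] Dx.
by have /negP[] := xVs _ (map_f _ VVs); rewrite Dx memv_add.
Qed.

End Escape.

(** * The Chowla number of a separable extension *)

Theorem corollary5p2 (K : fieldType) (L : fieldExtType K) (n : nat)
    (hn : \dim {:L} = n) (n_gt1 : (1 < n)%N)
    (hsep : separable 1%VS {:L}%VS) :
  chowla_number L = (n - dmax L)%N.
Proof.
have n1 : (1 < \dim {: L})%N by rewrite hn.
have [[E [Eproper dE]] dmaxP] := dmax_max n1.
have [[C [cC dC]] chowlaP] := chowla_number_max n1.
have d_gt0 : (0 < dmax L)%N by rewrite -dE adim_gt0.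
have d_half : (dmax L + dmax L <= n)%N.
  have /dvdnP[k Dn] : (\dim E %| n)%N by rewrite -hn field_dimS ?subvf.
  rewrite -dE Dn; case: k => [|[|k]] in Dn *.
  - by rewrite Dn in n_gt1.
  - by case: Eproper; apply/eqP; rewrite eqEdim subvf hn Dn mul1n leqnn.
  - by rewrite mulSn mulSn addnA leq_addr.
have d_le : (dmax L <= n - dmax L)%N.
  by rewrite -(leq_add2r (dmax L)) subnK // (leq_trans (leq_addr _ _) d_half).
apply/eqP; rewrite eqn_leq; apply/andP; split.
  rewrite leqNgt; apply/negP; rewrite -dC => gt_C.
  have CE0 : (C :&: E)%VS != 0%VS.
    apply: contraTneq gt_C => CE0; rewrite -leqNgt -dE -hn leq_subRL.
      by rewrite addnC -dimv_disjoint_sum // dimvS ?subvf.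
    exact/dimvS/subvf.
  have := memv_pick (C :&: E)%VS; rewrite memv_cap => /andP[aC aE].
  have := cC.2 _ aC; rewrite vpick0 => /(_ CE0); apply/negP; rewrite -leqNgt.
  apply: leq_trans (ltnW (leq_ltn_trans d_le gt_C)); rewrite -dE dimvS //.
  by apply/FadjoinP; rewrite sub1v.
have dP (F : {subfield L}) :
    F != {: L}%VS :> {vspace L} -> (\dim F <= dmax L)%N.
  by move/eqP; exact: dmaxP.
have escape (A : {vspace L}) : (\dim A < n - dmax L)%N ->
    exists x, forall a b, a \in A -> nongenerator b -> x <> a + b.
  rewrite -hn; have [[s sP]|large] := finite_or_large K.
    exact: (finite_field_escape dP sP).
  exact: (large_field_escape dP).
have N0 : nongenerator (0 : L).
  rewrite /nongenerator addv0 subfield_closed => L1.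
  by move: n1; rewrite -L1 dimv1.
have NZ (c : K) (x : L) : nongenerator x -> nongenerator (c *: x).
  move=> Nx Ncx; apply: Nx; apply/eqP; rewrite eqEsubv subvf -Ncx.
  by apply/FadjoinP; rewrite subv_adjoin memvZ ?memv_adjoin.
have [A [dA AN]] := subspace_avoiding N0 NZ escape.
rewrite -dA; apply: chowlaP; split=> [A0|a aA a0].
  by move: d_gt0; rewrite lt0n -leqn0 (leq_trans d_le) // -dA A0 dimv0.
have -> : <<1; a>>%VS = {: L}%VS.
  by apply: contrapT => Na; rewrite (AN a aA Na) eqxx in a0.
by rewrite dA hn ltn_subrL d_gt0 ltnW.
Qed.
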